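(* Let $n$ be a positive integer, let $A$ be a finite subset of a field $F$, and let $a_1,\ldots,a_n\in F^*$. (i) For any $f(x)\in F[x]$ with $\deg f=m\geqslant 1$, we have $$\bigl|\{a_1x_1+\cdots+a_nx_n:\ x_1,\ldots,x_n\in A,\ \text{and}\ f(x_i)\neq f(x_j)\ \text{if}\ i\neq j\}\bigr|\geqslant\min\left\{p(F)-m\binom n2,\ n\bigl(|A|-1-m(n-1)\bigr)+1\right\}.$$ (ii) Let $m$ be a positive integer, and let $S_{ij}\subseteq F$ with $|S_{ij}|\leqslant 2m-1$ for all $1\leqslant i<j\leqslant n$. Then $$\bigl|\{a_1x_1+\cdots+a_nx_n:\ x_1,\ldots,x_n\in A,\ \text{and}\ x_i-x_j\notin S_{ij}\ \text{if}\ i<j\}\bigr|\geqslant\min\left\{p(F)-(2m-1)\binom n2,\ n\bigl(|A|-1-(2m-1)(n-1)\bigr)+1\right\}.$$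
   Context: $F^*=F\setminus\{0\}$. $p(F)$ denotes the additive order of the multiplicative identity of $F$: it equals the characteristic of $F$ if this is a prime, and $p(F)=+\infty$ if $F$ has characteristic zero (in which case $\min\{p(F)-c,\,x\}=x$ for integers $c,x$). *)

(* Defs.v *)
From mathcomp Require Import all_boot all_order all_algebra.
From mathcomp Require Import finmap boolp constructive_ereal.
Set Implicit Arguments.
Unset Strict Implicit.
Unset Printing Implicit Defensive.
Import Order.TTheory GRing.Theory Num.Theory.
Local Open Scope ring_scope.
Local Open Scope fset_scope.

(* The additive order of 1 in F, with value +oo in characteristic 0. Extended
   integers are used because p(F) - c may be negative or +oo. *)
Definition p_of (F : fieldType) : \bar int :=
  if pselect (exists k : nat, (0 < k)%N && (k%:R == 0 :> F)) is left ex_k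
  then ((ex_minn ex_k)%:Z)%:E else +oo%E.

Definition restricted_sums (F : fieldType) (n : nat) (a : 'I_n -> F)
    (A : {fset F}) (P : pred ('I_n -> F)) : {fset F} :=
  [fset y in [seq \sum_(i < n) a i * fsval (x i)
     | x : {ffun 'I_n -> A} in [pred x : {ffun 'I_n -> A} | P (fun i => fsval (x i))]]].

Lemma p_of_pchar (F : fieldType) (p : nat) :
  p \in [pchar F] -> p_of F = (p%:Z)%:E.
Proof.
move=> pF; rewrite /p_of; case: pselect => [ex_k|[]]; last first.
  by exists p; rewrite prime_gt0 ?(pcharf_prime pF)// (pcharf0 pF) eqxx.
case: ex_minnP => k /andP[k0 /eqP kF] kmin; congr (_%:Z%:E).
apply/eqP; rewrite eqn_leq kmin ?prime_gt0 ?(pcharf_prime pF)//=; last first.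
  by rewrite (pcharf0 pF) eqxx.
by apply: dvdn_leq => //; rewrite (dvdn_pcharf pF) kF eqxx.
Qed.

Lemma p_of_pchar0 (F : fieldType) : [pchar F] =i pred0 -> p_of F = +oo%E.
Proof.
move=> /pcharf0P F0; rewrite /p_of; case: pselect => // ex_k.
by have [k /andP[k_gt0]] := ex_k; rewrite F0 -[k == _]negbK -lt0n k_gt0.
Qed.

Lemma in_restricted_sums (F : fieldType) (n : nat) (a : 'I_n -> F)
    (A : {fset F}) (P : pred ('I_n -> F)) (y : F) :
  reflect (exists x : 'I_n -> F, [/\ forall i, x i \in A, P x
            & y = \sum_(i < n) a i * x i])
          (y \in restricted_sums a A P).
Proof.
rewrite inE; apply: (iffP imageP) => [[x Px ->]|[x [xA Px ->]]].
  by exists (fun i => fsval (x i)); split => // i; apply: fsvalP.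
exists [ffun i => [` xA i]] => /=; last by apply: eq_bigr => i _; rewrite ffunE.
rewrite inE /=.
suff -> : (fun i => fsval ([ffun i => [` xA i]] i)) = x by [].
by apply/funext => i; rewrite ffunE.
Qed.

(* Main.v *)
Require Import Defs.
From mathcomp Require Import all_boot all_order all_algebra.
From mathcomp Require Import finmap boolp constructive_ereal.
From mathcomp Require Import ring zify.
From mathcomp Require Import -(notations) mpoly.
Set Implicit Arguments.
Unset Strict Implicit.
Unset Printing Implicit Defensive.
Import Order.TTheory GRing.Theory Num.Theory.
Local Open Scope ring_scope.

(** Both parts are instances of one statement about polynomials: if [P] has
degree [d] and [C] contains every sum [a_1 x_1 + ... + a_n x_n] with [x_i] in
[A] and [P(x)] nonzero, then [C] has at least
[min (p - d) (n (|A| - 1) - 2 d + 1)] elements, as soon as some monomial [X^k]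
of top degree of [P] has all its exponents below [|A|].  Here [P] is a product
over the pairs [i < j] of polynomials of degree [M] in [X_i] and [X_j] whose
leading monomial is [X_i^M], so that [d] is [M] times the number of pairs, and
[k_i = M (n - 1 - i)].  In part (i) the factor is [f(X_i) - f(X_j)]; in part
(ii) it is the product of the [X_i - X_j - s] for [s] in [S_ij], completed to
degree [2 m - 1] by a power of [X_i - X_j].

The bound on [C] uses Alon's polynomial method twice.  Put
[L = a_1 X_1 + ... + a_n X_n] and suppose that [C] is small, say [|C| <= K].
Multiplying [P] by the factors [L - c] for [c] in [C], and by further copies of
[L] if needed, gives a polynomial [T] of degree [d + K] that vanishes on the
grid [A^n].  By the Combinatorial Nullstellensatz, [T] has no monomial [X^m] of
degree [d + K] with all [m_i < |A|].  But the top degree part of [T] is that of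
[P * L^K], and expanding the power by the multinomial formula gives
[m! [X^m] T = K! a^m Q(m)], where [Q] comes from the top degree part
[sum_j P_j X^j] of [P] by replacing [X_i^(j_i)] with a falling factorial of
length [j_i] divided by [a_i^(j_i)].  Now [Q] has degree [d] and a nonzero
coefficient at [k], so the same Nullstellensatz, read in the basis of falling
factorials, gives a point [m] with [Q(m)] nonzero in every box
[t_i - k_i <= m_i <= t_i] ([linear_sums_card_lower]).  The degree of such an
[m] is not known beforehand: it lies between [|t| - d] and [|t|].  This costs
another [d], whence the term [2 d], and is harmless because enlarging [K] only
weakens the assumption on [C].  The characteristic matters in two
places only: [K!] must not vanish, which is why [|t|] is kept at most
[p - 1 + d], and the integers of each box must stay distinct in the field
([linear_sums_card_ge]). *)

(** * Nonvanishing on a grid *)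

(** On polynomials of degree at most [k], extracting the coefficient of degree
[k] is a linear combination of the values at any [k + 1] distinct points (a
divided difference), because the Vandermonde matrix of these points is
invertible. *)
Lemma top_coef_functional (F : fieldType) (k : nat) (b : nat -> F) :
  {in [pred j | (j <= k)%N] &, injective b} ->
  exists w : nat -> F, forall p : {poly F}, (size p <= k.+1)%N ->
    \sum_(j < k.+1) w j * p.[b j] = p`_k.
Proof.
move=> b_inj; pose V := Vandermonde k.+1 (\row_(j < k.+1) b j).
have V_unit : V \in unitmx.
  rewrite unitmxE det_Vandermonde unitfE; apply/prodf_neq0 => i _.
  apply/prodf_neq0 => j ij; rewrite !mxE subr_eq0.
  by apply: contraTneq ij => /b_inj ->; rewrite ?ltnn ?inE // -ltnS.
pose w : 'cV[F]_k.+1 := invmx V *m delta_mx ord_max 0.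
exists (fun j => w (inord j) 0) => p szp.
have <- : ((\row_(i < k.+1) p`_i) *m V *m w) 0 0 = p`_k.
  by rewrite -mulmxA mulKVmx // -colE !mxE.
rewrite mxE; apply: eq_bigr => j _; rewrite inord_val mulrC; congr (_ * _).
rewrite (horner_coef_wide _ szp) mxE.
by apply: eq_bigr => i _; rewrite !mxE.
Qed.

(** The Combinatorial Nullstellensatz, in a form independent of the polynomial
basis.  The product over [i] of the divided differences of order [k i] kills
every basis element of multidegree [m] other than [k], since an inequality
[mdeg m <= mdeg k] forces [m i < k i] for some [i]; so it maps the sum to
[c k], and the values of the sum on the grid cannot all vanish.  It is used with
powers and with falling factorials; the points are enumerated by natural
numbers because their number depends on the coordinate. *)
Lemma nonvanishing_on_grid (F : fieldType) (n : nat) (q : nat -> {poly F})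
    (b : 'I_n -> nat -> F) (r : seq (multinom n)) (c : multinom n -> F)
    (k : multinom n) :
  (forall j, q j \is monic) -> (forall j, size (q j) = j.+1) ->
  (forall i, {in [pred j | (j <= k i)%N] &, injective (b i)}) ->
  uniq r -> k \in r -> c k != 0 -> {in r, forall m, (mdeg m <= mdeg k)%N} ->
  exists2 f : 'I_n -> nat, (forall i, f i <= k i)%N
    & \sum_(m <- r) c m * \prod_i (q (m i)).[b i (f i)] != 0.
Proof.
move=> q_monic q_size b_inj r_uniq kr ck r_le.
have [w wP] : exists w : 'I_n -> nat -> F, forall i (p : {poly F}),
    (size p <= (k i).+1)%N -> \sum_(j < (k i).+1) w i j * p.[b i j] = p`_(k i).
  have [w wP] := choice (fun i => top_coef_functional (b_inj i)).
  by exists w.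
pose G (f : 'I_n -> nat) := \sum_(m <- r) c m * \prod_i (q (m i)).[b i (f i)].
pose N := mdeg k.
have kN i : (k i <= N)%N by rewrite /N mdegE (bigD1 i) //= leq_addr.
pose box : pred {ffun 'I_n -> 'I_N.+1} :=
  [pred f | f \in family (fun i => [pred j : 'I_N.+1 | (j < (k i).+1)%N])].
have sumG : \sum_(f in box) (\prod_i w i (f i)) * G (fun i => f i) = c k.
  have -> : \sum_(f in box) (\prod_i w i (f i)) * G (fun i => f i) =
      \sum_(m <- r) c m *
        \prod_i \sum_(j < (k i).+1) w i j * (q (m i)).[b i j].
    under eq_bigr do rewrite mulr_sumr; rewrite exchange_big /=.
    apply: eq_bigr => m _.
    under [in RHS]eq_bigr => i _ do
      rewrite (big_ord_widen N.+1 (fun j => w i j * (q (m i)).[b i j])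
        (kN i : (k i).+1 <= N.+1)%N).
    rewrite bigA_distr_big_dep mulr_sumr; apply: eq_bigr => f _.
    by rewrite big_split mulrCA.
  rewrite (bigD1_seq k) //= [X in _ + X]big1_seq ?addr0 => [|m /andP[mk mr]].
    rewrite big1 ?mulr1 // => i _; rewrite wP ?q_size //.
    by have /monicP := q_monic (k i); rewrite lead_coefE q_size.
(* If m >= k pointwise then the degree bound makes them equal. *)
  have [i mi] : exists i, (m i < k i)%N.
    apply/existsP; apply: contraR mk; rewrite negb_exists => /forallP le_km.
    have {}le_km i : (k i <= m i)%N by rewrite leqNgt.
    have := r_le _ mr; rewrite !mdegE => le_sum; apply/eqP/mnmP => i.
    apply/eqP; rewrite eqn_leq le_km andbT leqNgt; apply/negP => lt_km.
    move: le_sum; rewrite leqNgt => /negP; apply.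
    by rewrite [ltnLHS](bigD1 i) //= [ltnRHS](bigD1 i) //= -addSn leq_add // leq_sum.
  rewrite (bigD1 i) //= wP ?q_size ?ltnS 1?ltnW // nth_default ?q_size //.
  by rewrite mul0r mulr0.
have [f fbox Gf] : exists2 f : {ffun 'I_n -> 'I_N.+1}, f \in box & G (fun i => f i) != 0.
  apply/exists_inP; apply: contraNT ck; rewrite negb_exists => /forallP G0.
  rewrite -sumG big1 // => f fbox; move: (G0 f).
  by rewrite fbox /= negbK => /eqP ->; rewrite mulr0.
exists (fun i => f i) => // i.
by move: fbox => /familyP /(_ i); rewrite inE ltnS.
Qed.

(** * Coefficients of powers of a linear form *)

Definition linear_form (R : comNzRingType) (n : nat) (a : 'I_n -> R) : mpoly n R :=
  \sum_i a i *: mpolyX R (mnm1 i).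

Lemma meval_linear_form (R : comNzRingType) (n : nat) (a x : 'I_n -> R) :
  meval x (linear_form a) = \sum_i a i * x i.
Proof.
by rewrite raddf_sum; apply: eq_bigr => i _; rewrite /= mevalZ mevalXU.
Qed.

Lemma mderiv_linear_form (R : comNzRingType) (n : nat) (a : 'I_n -> R) (i : 'I_n) :
  mderiv i (linear_form a) = mpolyC n (a i).
Proof.
rewrite raddf_sum (bigD1 i) //= [X in _ + X]big1 => [|j ji].
  rewrite mderivZ mderivX mnm1E eqxx scale1r -[X in mnm_sub X _]add0m addmK mpolyX0.
  by rewrite addr0 -mul_mpolyC mulr1.
by rewrite mderivZ mderivX mnm1E (negbTE ji) scale0r scaler0.
Qed.

Lemma mderiv_linear_form_exp (R : comNzRingType) (n : nat) (a : 'I_n -> R)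
    (i : 'I_n) (K : nat) :
  mderiv i (linear_form a ^+ K.+1) = (a i *+ K.+1) *: linear_form a ^+ K.
Proof.
elim: K => [|K IH].
  by rewrite expr1 expr0 mulr1n mderiv_linear_form -mul_mpolyC mulr1.
rewrite exprS mderivM IH mderiv_linear_form -scalerAr -exprS mul_mpolyC.
by rewrite -scalerDl -mulrS.
Qed.

(** The multinomial formula, with the factorials kept on the left so that no
division occurs and any characteristic is allowed.  Comparing the coefficients
of both sides of [d/dX_i L^(K+1) = (K+1) a_i L^K] gives the induction step. *)
Lemma mcoeff_linear_form_exp (R : comNzRingType) (n : nat) (a : 'I_n -> R)
    (K : nat) (m : multinom n) : mdeg m = K ->
  mcoeff m (linear_form a ^+ K) *+ (\prod_i (m i)`!)%N =
    (\prod_i a i ^+ m i) *+ K`!.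
Proof.
elim: K m => [|K IH] m degm.
  have /eqP -> : m == mnm0 by rewrite -mdeg_eq0 degm.
  rewrite expr0 mcoeff1 eqxx !big1 // => i _; by rewrite mnm0E.
have [i mi] : exists i, (0 < m i)%N.
  apply/existsP; apply: contra_eqT degm; rewrite negb_exists => /forallP m0.
  by rewrite mdegE big1 // => i _; apply/eqP; rewrite -leqn0 leqNgt.
pose m' := mnm_sub m (mnm1 i).
have mE : m = mnm_add m' (mnm1 i).
  by rewrite submK //; apply/mnm_lepP => j; rewrite mnm1E; case: eqP => // <-.
have degm' : mdeg m' = K by move: degm; rewrite mE mdegD mdeg1 addn1 => -[].
have miE : m i = (m' i).+1 by rewrite mE mnmDE mnm1E eqxx addn1.
have mjE j : j != i -> m j = m' j.
  by move=> ji; rewrite mE mnmDE mnm1E eq_sym (negbTE ji) addn0.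
have fact_m : (\prod_j (m j)`! = (m i) * \prod_j (m' j)`!)%N.
  rewrite (bigD1 i) //= [in RHS](bigD1 i) //= miE factS mulnA; congr (_ * _)%N.
  by apply: eq_bigr => j /mjE ->.
have a_m : \prod_j a j ^+ m j = a i * \prod_j a j ^+ m' j.
  rewrite (bigD1 i) //= [in RHS](bigD1 i) //= miE exprS mulrA; congr (_ * _).
  by apply: eq_bigr => j /mjE ->.
have := mcoeff_deriv i m' (linear_form a ^+ K.+1).
rewrite -mE -miE mderiv_linear_form_exp mcoeffZ => dm.
by rewrite fact_m mulrnA -dm -mulrnAr IH // a_m factS mulrnA mulrnAr -!mulrnAl.
Qed.

Lemma mcoeff_linear_form_exp_eq0 (R : comNzRingType) (n : nat) (a : 'I_n -> R)
    (K : nat) (m : multinom n) :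
  mdeg m != K -> mcoeff m (linear_form a ^+ K) = 0.
Proof.
apply: dhomog_nemf_coeff; rewrite -[K in ishomog1 K]mul1n; apply: dhomogMn.
by apply: rpred_sum => i _; apply: rpredZ; rewrite dhomogX /= mdeg1.
Qed.

Lemma mcoeffXM (R : comNzRingType) (n : nat) (p : mpoly n R) (m k : multinom n) :
  mcoeff m (mpolyX R k * p) = if lem k m then mcoeff (mnm_sub m k) p else 0.
Proof.
rewrite mulrC; case: ifPn => [km|].
  by rewrite -[in LHS](submK km) addmC mcoeffMX.
apply: contraNeq; rewrite -mcoeff_msupp (perm_mem (msuppMX _ _)).
by case/mapP => m' _ ->; exact: lem_addr.
Qed.

Lemma mcoeff_mul_linear_form_exp_eq0 (R : comNzRingType) (n : nat) (a : 'I_n -> R)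
    (P : mpoly n R) (d K : nat) (m : multinom n) :
  {in msupp P, forall j, (mdeg j <= d)%N} -> (d + K < mdeg m)%N ->
  mcoeff m (P * linear_form a ^+ K) = 0.
Proof.
move=> degP degm; rewrite [P]mpolyE mulr_suml raddf_sum big1_seq // => j.
move=> /andP[_ /degP degj]; rewrite /= -scalerAl mcoeffZ mcoeffXM.
case: ifP => [jm|]; rewrite ?mulr0 // mcoeff_linear_form_exp_eq0 ?mulr0 //.
by move: degm; rewrite -{1}(submK jm) mdegD; lia.
Qed.

(** Multiplying by a power of a linear form turns the top degree part
[sum_j P_j X^j] of [P] into the function [sum_j P_j / a^j * (m)_j] of the
exponent [m], where [(m)_j] is a product of falling factorials: the quotient
[m! / (m - j)!] of factorials in the multinomial formula is [(m)_j]. *)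
Lemma mcoeff_mul_linear_form_exp (F : fieldType) (n : nat) (a : 'I_n -> F)
    (P : mpoly n F) (d K : nat) (m : multinom n) :
  (forall i, a i != 0) ->
  {in msupp P, forall j, (mdeg j <= d)%N} -> mdeg m = (d + K)%N ->
  mcoeff m (P * linear_form a ^+ K) *+ (\prod_i (m i)`!)%N =
    (\prod_i a i ^+ m i *
      \sum_(j <- msupp P | mdeg j == d)
         mcoeff j P / \prod_i a i ^+ j i * \prod_i (m i ^_ j i)%:R) *+ K`!.
Proof.
move=> a_neq0 degP degm.
rewrite {1}[P]mpolyE mulr_suml raddf_sum /= -sumrMnl.
rewrite mulr_sumr -sumrMnl [in RHS]big_mkcond /=.
apply: eq_big_seq => j /degP degj.
rewrite -scalerAl mcoeffZ mcoeffXM; case: eqP => [|/eqP] degj'; last first.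
  case: ifP => jm; rewrite ?mulr0 ?mul0rn //.
  rewrite mcoeff_linear_form_exp_eq0 ?mulr0 ?mul0rn //.
  by move: degm; rewrite -{1}(submK jm) mdegD; lia.
case: ifPn => [jm|jm]; last first.
  rewrite mulr0 mul0rn.
  have [i mi] : exists i, (m i < j i)%N.
    apply/existsP; apply: contraR jm; rewrite negb_exists => /forallP H.
    by apply/mnm_lepP => i; rewrite leqNgt.
  rewrite [X in _ * (_ * X)](bigD1 i) //= ffact_small // mul0r !mulr0.
  by rewrite mul0rn.
have jmi i : (j i <= m i)%N by move/mnm_lepP: jm.
have -> : (\prod_i (m i)`! =
    (\prod_i (mnm_sub m j i)`!) * \prod_i (m i ^_ j i))%N.
  rewrite -big_split; apply: eq_bigr => i _ /=.
  by rewrite mnmBE mulnC ffact_fact.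
have -> : \prod_i a i ^+ m i =
    (\prod_i a i ^+ j i) * \prod_i a i ^+ (mnm_sub m j) i.
  by rewrite -big_split; apply: eq_bigr => i _; rewrite /= mnmBE -exprD subnKC.
rewrite mulrnA -mulrnAr mcoeff_linear_form_exp; last first.
  by move: degm; rewrite -{1}(submK jm) mdegD; lia.
rewrite -natr_prod -[LHS]mulr_natr -[RHS]mulr_natr -[(\prod_i _) *+ K`!]mulr_natr.
have : \prod_i a i ^+ j i != 0 by apply/prodf_neq0 => i _; rewrite expf_neq0.
by move=> ?; field.
Qed.

(** Only the top degree matters: replacing factors [L] by [L - c] changes lower
degree coefficients only. *)
Lemma mcoeff_mul_translates (R : comNzRingType) (n : nat) (a : 'I_n -> R)
    (P : mpoly n R) (d : nat) (cs : seq R) (m : multinom n) :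
  {in msupp P, forall j, (mdeg j <= d)%N} -> (d + size cs <= mdeg m)%N ->
  mcoeff m (P * \prod_(c <- cs) (linear_form a - mpolyC n c)) =
    mcoeff m (P * linear_form a ^+ size cs).
Proof.
elim: cs P d => [|c cs IH] P d degP degm; first by rewrite big_nil expr0.
rewrite big_cons mulrA (IH _ d.+1) ?addSnnS //; last first.
  move=> j; rewrite mulrBr mcoeff_msupp mcoeffB mulrC; apply: contraR.
  rewrite -ltnNge => degj; rewrite [_ * P]mulrC [P * mpolyC _ _]mulrC mcoeffCM.
  rewrite -[linear_form a]expr1 (mcoeff_mul_linear_form_exp_eq0 _ degP) ?addn1 //.
  by rewrite (memN_msupp_eq0 _) ?mulr0 ?subr0 //; apply: contraTN degj => /degP; lia.
rewrite /= exprS mulrA mulrBr mulrBl mcoeffB [P * mpolyC _ _]mulrC -[mpolyC _ _ * P * _]mulrA mcoeffCM.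
by rewrite (mcoeff_mul_linear_form_exp_eq0 _ degP) ?mulr0 ?subr0 // -addnS.
Qed.

(** * Lower bound for the number of values *)

Lemma horner_falling (R : comNzRingType) (x j : nat) :
  (\prod_(0 <= r < j) ('X - (r%:R)%:P)).[x%:R] = (x ^_ j)%:R :> R.
Proof.
elim: j => [|j IH]; first by rewrite big_geq ?hornerC.
rewrite big_nat_recr //= hornerM IH !hornerE ffactnSr natrM.
by case: (leqP j x) => jx; [rewrite natrB|rewrite ffact_small // !mul0r].
Qed.

(** A difference of two distinct integers of [0, t] divides [t!] up to sign. *)
Lemma natr_inj_of_fact (R : nzRingType) (t : nat) : (t`!)%:R != 0 :> R ->
  {in [pred x | (x <= t)%N] &, injective (fun x => x%:R : R)}.
Proof.
move=> t_fact x y; rewrite !inE; wlog xy : x y / (x <= y)%N.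
  move=> H xt yt xy; case: (leqP x y) => [/H|/ltnW /H]; first exact.
  by move=> ->.
move=> _ yt /eqP; rewrite eq_sym -subr_eq0 -natrB // => yx0.
apply/eqP; rewrite eqn_leq xy -subn_eq0 /=; apply: contraNT t_fact.
rewrite -lt0n => yx; have /dvdnP[e ->] : (y - x %| t`!)%N.
  by rewrite dvdn_fact ?yx //=; lia.
by rewrite natrM (eqP yx0) mulr0.
Qed.

(** The polynomial method.  If [C] were too small, the product of [P] with
enough factors [L - c] would vanish on the grid; a nonvanishing point [m] of the
falling factorial transform of [P], found in the box between [t - k] and [t],
exhibits a top degree monomial of this product that forbids it. *)
Lemma linear_sums_card_lower (F : fieldType) (n : nat) (a : 'I_n -> F)
    (A : 'I_n -> seq F) (P : mpoly n F) (k t : multinom n) (C : seq F) :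
  (forall i, a i != 0) -> (forall i, uniq (A i)) ->
  mcoeff k P != 0 -> {in msupp P, forall j, (mdeg j <= mdeg k)%N} ->
  (forall i, k i <= t i < size (A i))%N ->
  (forall i, (t i)`!%:R != 0 :> F) -> (mdeg t - mdeg k)`!%:R != 0 :> F ->
  (forall x : 'I_n -> F, (forall i, x i \in A i) -> meval x P != 0 ->
     \sum_i a i * x i \in C) ->
  (mdeg t < size C + (mdeg k).*2)%N.
Proof.
move=> a_neq0 A_uniq Pk degP kt t_fact K_fact sums_C.
rewrite ltnNge; apply/negP => C_small; set d := mdeg k in degP K_fact C_small *.
pose q j : {poly F} := \prod_(0 <= r < j) ('X - (r%:R)%:P).
(* f i is the position of the wanted exponent in the interval from t i - k i to
   t i. *)
have [f f_le] : exists2 f : 'I_n -> nat, (forall i, f i <= k i)%N &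
  \sum_(j <- [seq j <- msupp P | mdeg j == d])
     mcoeff j P / \prod_i a i ^+ j i * \prod_i (q (j i)).[(t i - k i + f i)%:R] != 0.
  apply: (nonvanishing_on_grid (b := fun i l => (t i - k i + l)%:R)).
  - by move=> j; apply: monic_prod_XsubC.
  - by move=> j; rewrite /q size_prod_XsubC size_iota subn0.
  - move=> i x y; rewrite !inE => xk yk /natr_inj_of_fact; have := kt i.
    move=> kti /(_ (t i) (t_fact i)) H; apply: (@addnI (t i - k i)%N).
    by apply: H; rewrite !inE; lia.
  - by rewrite filter_uniq.
  - by rewrite mem_filter eqxx mcoeff_msupp.
  - by rewrite mulf_neq0 ?invr_eq0 //; apply/prodf_neq0 => i _; rewrite expf_neq0.
  - by move=> j; rewrite mem_filter => /andP[/eqP ->].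
pose m := Multinom [tuple (t i - k i + f i)%N | i < n].
have mE i : m i = (t i - k i + f i)%N by rewrite mnmE.
have mt i : (m i <= t i)%N by have := kt i; have := f_le i; rewrite mE; lia.
rewrite big_filter => Pm.
have degt_m : (mdeg t <= mdeg m + d)%N.
  rewrite /d !mdegE -big_split; apply: leq_sum => i _ /=.
  by rewrite mE; have := kt i; lia.
have degm_t : (mdeg m <= mdeg t)%N by rewrite !mdegE; exact: leq_sum.
pose K := (mdeg m - d)%N.
have degm : mdeg m = (d + K)%N by rewrite /K; lia.
(* Repeated factors L - 0 bring the degree to that of X^m. *)
pose cs := C ++ nseq (K - size C) 0.
have size_cs : size cs = K by rewrite size_cat size_nseq /K; lia.
pose T := P * \prod_(c <- cs) (linear_form a - mpolyC n c).
have Tm : mcoeff m T != 0.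
  rewrite /T (mcoeff_mul_translates _ degP) size_cs -?degm //.
  have := mcoeff_mul_linear_form_exp a_neq0 degP degm.
  apply: contra_eq_neq => ->; rewrite mul0rn eq_sym -mulr_natr !mulf_neq0 //.
  - by apply/prodf_neq0 => i _; rewrite expf_neq0.
  - apply: contraNneq Pm => S0; rewrite -[X in _ == X]S0; apply/eqP.
    apply: eq_bigr => j _; congr (_ * _).
    by apply: eq_bigr => i _; rewrite -mE /q horner_falling.
  - have Kt : (K <= mdeg t - d)%N by rewrite /K; lia.
    by apply: contraNneq K_fact => K0; rewrite (fact_split Kt) natrM K0 mul0r.
have degT : {in msupp T, forall j, (mdeg j <= mdeg m)%N}.
  move=> j; rewrite mcoeff_msupp; apply: contraR; rewrite -ltnNge => degj.
  rewrite (mcoeff_mul_translates _ degP) size_cs -?degm; last exact: ltnW.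
  by rewrite (mcoeff_mul_linear_form_exp_eq0 _ degP) // -degm.
have m_size i : (m i < size (A i))%N.
  by apply: leq_ltn_trans (mt i) _; case/andP: (kt i).
(* The Nullstellensatz applies to the first m i + 1 elements of each A i. *)
have A_inj i : {in [pred j | (j <= m i)%N] &, injective (nth 0 (A i))}.
  move=> x y; rewrite !inE => xm ym /eqP; rewrite nth_uniq ?A_uniq //.
  - by move/eqP.
  - exact: leq_ltn_trans xm (m_size i).
  - exact: leq_ltn_trans ym (m_size i).
have [g g_le] : exists2 g : 'I_n -> nat, (forall i, g i <= m i)%N &
    \sum_(j <- msupp T) mcoeff j T * \prod_i ('X^(j i)).[nth 0 (A i) (g i)] != 0.
  apply: (nonvanishing_on_grid _ _ A_inj _ _ Tm degT); first exact: monicXn.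
  - exact: size_polyXn.
  - exact: msupp_uniq.
  - by rewrite mcoeff_msupp.
pose x i := nth 0 (A i) (g i).
have xA i : x i \in A i by rewrite mem_nth // (leq_ltn_trans (g_le i)).
under eq_bigr do under eq_bigr do rewrite hornerXn.
rewrite -(mevalE x) /T mevalM; have [->|/(sums_C _ xA) xC] := eqVneq (meval x P) 0.
  by rewrite mul0r eqxx.
rewrite (big_rem (\sum_i a i * x i)) /=; last by rewrite mem_cat xC.
by rewrite mevalM mevalB meval_linear_form mevalC subrr mul0r mulr0 eqxx.
Qed.

(** Discrete intermediate values: raise one exponent at a time. *)
Lemma multinom_between (n : nat) (k u : multinom n) (N : nat) :
  (forall i, k i <= u i)%N -> (mdeg k <= N <= mdeg u)%N ->
  exists2 t : multinom n, (forall i, k i <= t i <= u i)%N & mdeg t = N.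
Proof.
move=> ku /andP[]; move Es: (N - mdeg k)%N => s kN Nu.
elim: s k ku Es kN => [|s IH] k ku Es kN.
  by exists k => [i|]; [rewrite leqnn ku | lia].
have [i ki] : exists i, (k i < u i)%N.
  apply/existsP; apply: contraLR Nu; rewrite negb_exists => /forallP uk.
  rewrite -ltnNge; have : (mdeg u <= mdeg k)%N; last by lia.
  by rewrite !mdegE; apply: leq_sum => i _; rewrite leqNgt.
have [|||t kt degt] := IH (mnm_add k (mnm1 i)).
- by move=> j; rewrite mnmDE mnm1E; case: eqP => [<-|_]; rewrite ?addn1 ?addn0.
- by rewrite mdegD mdeg1; lia.
- by rewrite mdegD mdeg1; lia.
exists t => // j; have /andP[kj ->] := kt j; rewrite andbT.
by apply: leq_trans kj; rewrite mnmDE leq_addr.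
Qed.

Lemma natr_fact_neq0 (R : idomainType) (p t : nat) :
  (forall r : nat, (0 < r < p)%N -> r%:R != 0 :> R) -> (t < p)%N -> t`!%:R != 0 :> R.
Proof.
move=> p_ord; elim: t => [|t IH] tp; first by rewrite oner_neq0.
by rewrite factS natrM mulf_neq0 ?IH ?p_ord // ltnW.
Qed.

(** The best box for a constant family of sets.  Here [p] is any bound below
which positive integers are invertible, so that characteristic zero is covered by taking
[p] large.  The exponents [t i] have to stay below both [size A] and [p], while
their sum should be as close as possible to [p - 1 + mdeg k], beyond which a
factorial vanishes; the hypothesis [mdeg k <= n.-1 * p.-1] says that this sum is
still reached after capping the exponents at [p - 1]. *)
Lemma linear_sums_card_ge (F : fieldType) (n p : nat) (a : 'I_n -> F)
    (A : seq F) (P : mpoly n F) (k : multinom n) (C : seq F) :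
  (0 < n)%N -> (forall i, a i != 0) -> uniq A ->
  (forall r : nat, (0 < r < p)%N -> r%:R != 0 :> F) ->
  mcoeff k P != 0 -> {in msupp P, forall j, (mdeg j <= mdeg k)%N} ->
  (forall i, k i < size A)%N -> (mdeg k < p)%N -> (mdeg k <= n.-1 * p.-1)%N ->
  (forall x : 'I_n -> F, (forall i, x i \in A) -> meval x P != 0 ->
     \sum_i a i * x i \in C) ->
  (minn (p - mdeg k) (n * (size A).-1 + 1 - (mdeg k).*2) <= size C)%N.
Proof.
move=> n_gt0 a_neq0 A_uniq p_ord Pk degP kA kp knp sums_C.
pose u0 := minn (size A).-1 p.-1.
pose u := Multinom [tuple u0 | i < n].
have uE i : u i = u0 by rewrite mnmE.
pose N := minn (n * (size A).-1) (p.-1 + mdeg k).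
have mdeg_const (v : multinom n) c : (forall i, v i <= c)%N -> (mdeg v <= n * c)%N.
  move=> vc; rewrite mdegE -[n in (n * c)%N]card_ord -sum_nat_const.
  exact: leq_sum.
have degu : mdeg u = (n * u0)%N.
  rewrite mdegE; under eq_bigr do rewrite uE.
  by rewrite sum_nat_const card_ord.
have ki_k i : (k i <= mdeg k)%N by rewrite mdegE (bigD1 i) //= leq_addr.
have kA' i : (k i <= (size A).-1)%N by have := kA i; case: (size A).
have [i||t kt degt] := @multinom_between n k u N.
- by rewrite uE leq_min kA'; have := ki_k i; lia.
- have kn := mdeg_const _ _ kA'.
  rewrite degu /N /u0; case: (leqP (size A).-1 p.-1) => [Ap|/ltnW pA].
    by rewrite leq_min kn leq_addl geq_minl.
  rewrite leq_min kn leq_addl (leq_trans (geq_minr _ _)) //.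
  by rewrite -[X in (_ <= X * _)%N](prednK n_gt0) mulSn leq_add2l.
have t_small i : (t i <= u0)%N by have := kt i; rewrite uE => /andP[].
have : (mdeg t < size C + (mdeg k).*2)%N.
  apply: (linear_sums_card_lower (A := fun=> A) a_neq0) Pk degP _ _ _ _ => //.
  - move=> i; have := kt i; have := t_small i; have := kA i; rewrite /u0; lia.
  - move=> i; apply: natr_fact_neq0 p_ord _; have := t_small i; rewrite /u0; lia.
  - by apply: natr_fact_neq0 p_ord _; rewrite degt /N; lia.
rewrite degt /N; lia.
Qed.

(** * Conditions on pairs of coordinates *)

Lemma mlead_prod_pairs (R : idomainType) (n M : nat)
    (g : 'I_n -> 'I_n -> mpoly n R) :
  (forall i j : 'I_n, (i < j)%N ->
     g i j != 0 /\ mlead (g i j) = mnm_muln (mnm1 i) M) ->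
  let P := \prod_(i < n) \prod_(j < n | (i < j)%N) g i j in
  [/\ P != 0, mdeg (mlead P) = (M * 'C(n, 2))%N
    & forall i, (mlead P i <= M * n.-1)%N].
Proof.
move=> g_lead P.
have row_neq0 (i : 'I_n) : \prod_(j < n | (i < j)%N) g i j != 0.
  by apply/prodf_neq0 => j /g_lead[].
have row_lead (i : 'I_n) : mlead (\prod_(j < n | (i < j)%N) g i j) =
    mnm_muln (mnm1 i) (\sum_(j < n | (i < j)%N) M).
  rewrite mlead_prod => [|j _ /g_lead[] //].
  apply/mnmP => l; rewrite mnm_sumE mulmnE big_distrr.
  by apply: eq_bigr => j /g_lead[_ ->]; rewrite mulmnE.
have P_lead : mlead P =
    \big[mnm_add/@mnm0 n]_(i < n) mnm_muln (mnm1 i) (\sum_(j < n | (i < j)%N) M).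
  by rewrite mlead_prod //; apply: eq_bigr => i _; rewrite row_lead.
split; first by apply/prodf_neq0.
  rewrite P_lead mdeg_sum (eq_bigr (fun i : 'I_n => \sum_(j < n | (i < j)%N) M)%N).
    rewrite (exchange_big_dep predT) //= -bin2_sum big_mkord big_distrr.
    apply: eq_bigr => j _ /=.
    rewrite -(big_ord_widen _ (fun=> M) (ltnW (ltn_ord j))).
    by rewrite sum_nat_const card_ord mulnC.
  by move=> i _; rewrite mdegMn mdeg1 mul1n.
move=> i; rewrite P_lead mnm_sumE (bigD1 i) //= [X in (_ + X)%N]big1 => [|j ji]; last first.
  by rewrite mulmnE mnm1E (negbTE ji).
rewrite addn0 mulmnE mnm1E eqxx mul1n mulnC.
have <- : (\sum_(j < n | j != i) M = n.-1 * M)%N.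
  by rewrite sum_nat_const cardC1 card_ord.
rewrite [leqLHS]big_mkcond [leqRHS]big_mkcond; apply: leq_sum => j _.
by case: eqP => [->|_]; rewrite ?ltnn //; case: ifP.
Qed.

(** When one of the two terms of the minimum is not positive, the corresponding
alternative is trivial; this leaves the case [M * (n - 1) < size A] and
[M * 'C(n, 2) < p] in which the box argument works. *)
Lemma pairwise_sums_card_ge (F : fieldType) (n p M : nat) (a : 'I_n -> F)
    (A C : seq F) (g : 'I_n -> 'I_n -> mpoly n F) :
  (0 < n)%N -> (forall i, a i != 0) -> uniq A ->
  (forall r : nat, (0 < r < p)%N -> r%:R != 0 :> F) ->
  (forall i j : 'I_n, (i < j)%N ->
     g i j != 0 /\ mlead (g i j) = mnm_muln (mnm1 i) M) ->
  (forall x : 'I_n -> F, (forall i, x i \in A) ->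
     (forall i j : 'I_n, (i < j)%N -> meval x (g i j) != 0) ->
     \sum_i a i * x i \in C) ->
  (p <= size C + M * 'C(n, 2))%N \/
  n%:Z * ((size A)%:Z - 1 - M%:Z * (n%:Z - 1)) + 1 <= (size C)%:Z.
Proof.
move=> n_gt0 a_neq0 A_uniq p_ord g_lead sums_C.
have [P_neq0 degP leP] := mlead_prod_pairs g_lead.
set P := \prod_i _ in P_neq0 degP leP; set d := (M * _)%N in degP *.
have d2 : (d.*2 = M * n.-1 * n)%N.
  by have := bin_ffact n 2; rewrite ffactnS ffactn1 -muln2 /d -mulnA => ->; lia.
have [pd|dp] := leqP p d; first by left; lia.
have [A_small|A_large] := leqP (size A) (M * n.-1).
  by right; nia.
have dn : (d <= n.-1 * p.-1)%N.
(* For n = 1 there are no pairs, hence d = 0. *)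
  have [n1|n1] := posnP n.-1; first by rewrite n1 muln0 in d2; lia.
  by apply: leq_trans (leq_pmull _ n1); lia.
have := @linear_sums_card_ge F n p a A P (mlead P) C n_gt0 a_neq0 A_uniq p_ord.
rewrite degP mleadc_eq0 => /(_ P_neq0) H.
have {}H : (minn (p - d) (n * (size A).-1 + 1 - d.*2) <= size C)%N.
  apply: H => // [j /msupp_le_mlead /lemc_mdeg|i|x xA Px].
  - by rewrite degP.
  - exact: leq_ltn_trans (leP i) _.
  apply: sums_C => // i j ij; apply: contraNneq Px => gij0.
  by rewrite /P (bigD1 i) //= (bigD1 j) //= !mevalM gij0 !mul0r.
have [H1|H2] : (p - d <= size C)%N \/ (n * (size A).-1 + 1 - d.*2 <= size C)%N by lia.
  by left; lia.
right; rewrite d2 in H2; nia.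
Qed.

Lemma p_of_sums_card_ge (F : fieldType) (n M : nat) (a : 'I_n -> F)
    (A C : {fset F}) (g : 'I_n -> 'I_n -> mpoly n F) :
  (0 < n)%N -> (forall i, a i != 0) ->
  (forall i j : 'I_n, (i < j)%N ->
     g i j != 0 /\ mlead (g i j) = mnm_muln (mnm1 i) M) ->
  (forall x : 'I_n -> F, (forall i, x i \in A) ->
     (forall i j : 'I_n, (i < j)%N -> meval x (g i j) != 0) ->
     \sum_i a i * x i \in C) ->
  (Order.min (p_of F - ((M * 'C(n, 2))%N%:Z)%:E)
     (n%:Z * (#|` A|%:Z - 1 - M%:Z * (n%:Z - 1)) + 1)%R%:E
   <= ((#|` C|)%:Z)%:E)%E.
Proof.
move=> n_gt0 a_neq0 g_lead sums_C; rewrite ge_min.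
have bound p p_ord :=
  @pairwise_sums_card_ge F n p M a A C g n_gt0 a_neq0 (fset_uniq A) p_ord g_lead sums_C.
rewrite /p_of; case: pselect => [ex_p|no_p].
  case: ex_minnP => p _ p_min; have [r /andP[r0 rp]||] := bound p.
  - by apply: contraTneq rp => r00; rewrite -leqNgt p_min // r0 r00 eqxx.
  - by move=> H; apply/orP; left; rewrite -EFinB lee_fin lerBlDr -PoszD lez_nat.
  - by move=> H; apply/orP; right; rewrite lee_fin.
(* In characteristic zero, a bound this large excludes the first alternative. *)
have [r /andP[r0 _]||H] := bound (size C + M * 'C(n, 2)).+1.
- by apply/negP => r00; apply: no_p; exists r; rewrite r0.
- by rewrite ltnn.
- by apply/orP; right; rewrite lee_fin.
Qed.

(** * The two families of conditions *)

(** In the order on monomials, smaller indices are more significant. *)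
Lemma mlead_subXn (R : nzRingType) (n m : nat) (i j : 'I_n) :
  (i < j)%N -> (0 < m)%N ->
  mlead (mpolyX R (mnm1 i) ^+ m - mpolyX R (mnm1 j) ^+ m) =
    mnm_muln (mnm1 i) m.
Proof.
move=> ij m_gt0; rewrite !mpolyXn mleadDl mleadXm // mleadN mleadXm.
apply/ltmcP; first by rewrite !mdegMn !mdeg1.
have ji : (j == i) = false by apply: gtn_eqF.
exists i => [l li|]; last by rewrite !mulmnE !mnm1E eqxx ji mul0n mul1n.
have il : (i == l) = false by apply: gtn_eqF.
have jl : (j == l) = false by apply: gtn_eqF; apply: ltn_trans ij.
by rewrite !mulmnE !mnm1E il jl.
Qed.

Lemma mlead_neq0 (R : nzRingType) (n m : nat) (i : 'I_n) (p : mpoly n R) :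
  (0 < m)%N -> mlead p = mnm_muln (mnm1 i) m -> p != 0.
Proof.
move=> m_gt0 p_lead; apply: contraTneq m_gt0 => p0; move: p_lead.
by rewrite p0 mlead0 => /mnmP/(_ i); rewrite mnm0E mulmnE mnm1E eqxx mul1n => <-.
Qed.

Definition poly_gap (R : comNzRingType) (n : nat) (f : {poly R}) (i j : 'I_n) :
    mpoly n R :=
  \sum_(r < size f) f`_r *: (mpolyX R (mnm1 i) ^+ r - mpolyX R (mnm1 j) ^+ r).

Lemma meval_poly_gap (R : comNzRingType) (n : nat) (f : {poly R}) (i j : 'I_n)
    (x : 'I_n -> R) : meval x (poly_gap f i j) = f.[x i] - f.[x j].
Proof.
rewrite raddf_sum !horner_coef -sumrB; apply: eq_bigr => r _ /=.
by rewrite mevalZ mevalB !rmorphXn /= !mevalXU mulrBr.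
Qed.

Lemma mlead_poly_gap (R : idomainType) (n m : nat) (f : {poly R}) (i j : 'I_n) :
  (i < j)%N -> (0 < m)%N -> size f = m.+1 ->
  mlead (poly_gap f i j) = mnm_muln (mnm1 i) m.
Proof.
move=> ij m_gt0 szf; rewrite /poly_gap szf big_ord_recr /=.
have fm : f`_m != 0.
  by have := lead_coef_eq0 f; rewrite lead_coefE szf -size_poly_eq0 szf /= => ->.
have top : mlead (f`_m *: (mpolyX R (mnm1 i) ^+ m - mpolyX R (mnm1 j) ^+ m)) =
    mnm_muln (mnm1 i) m by rewrite mleadZ // mlead_subXn.
have low k : (mdeg k < m)%N -> (k < mnm_muln (mnm1 i) m)%O.
  by move=> km; apply: lt_mdeg_ltmc; rewrite mdegMn mdeg1 mul1n.
rewrite mleadDr top //; apply: (big_ind (fun q => (mlead q < _)%O)).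
- by rewrite mlead0 low ?mdeg0.
- by move=> p q pm qm; apply: le_lt_trans (mleadD_le _ _) _; rewrite ltUx pm qm.
move=> r _; apply: le_lt_trans (mleadZ_le _ _) _.
apply: le_lt_trans (mleadB_le _ _) _; rewrite !mpolyXn !mleadXm ltUx.
by rewrite !low // mdegMn mdeg1 mul1n.
Qed.

(** The power of the difference makes the degree equal to [M] whatever the size
of [s]; for [size s < M] it also excludes [x i = x j], which can only shrink the
set of sums. *)
Definition shifted_gap (R : comNzRingType) (n M : nat) (s : seq R) (i j : 'I_n) :
    mpoly n R :=
  let D := mpolyX R (mnm1 i) - mpolyX R (mnm1 j) in
  D ^+ (M - size s) * \prod_(c <- s) (D - mpolyC n c).

Lemma meval_shifted_gap_eq0 (R : comNzRingType) (n M : nat) (s : seq R)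
    (i j : 'I_n) (x : 'I_n -> R) :
  x i - x j \in s -> meval x (shifted_gap M s i j) = 0.
Proof.
move=> xs; rewrite /shifted_gap (big_rem (x i - x j)) //= !mevalM !mevalB.
by rewrite !mevalXU mevalC subrr mul0r mulr0.
Qed.

Lemma mlead_shifted_gap (R : idomainType) (n M : nat) (s : seq R) (i j : 'I_n) :
  (i < j)%N -> (size s <= M)%N ->
  shifted_gap M s i j != 0 /\ mlead (shifted_gap M s i j) = mnm_muln (mnm1 i) M.
Proof.
move=> ij sM; rewrite /shifted_gap.
set D := _ - _.
have D_lead : mlead D = mnm1 i by have := mlead_subXn R ij (ltn0Sn 0); rewrite !expr1.
have D_neq0 : D != 0 by apply: (mlead_neq0 (ltn0Sn 0)) D_lead.
have Dc_lead c : mlead (D - mpolyC n c) = mnm1 i.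
  by rewrite mleadDl D_lead // mleadN mleadC lt_mdeg_ltmc // mdeg0 mdeg1.
have Dc_neq0 c : D - mpolyC n c != 0 by apply: (mlead_neq0 (ltn0Sn 0)) (Dc_lead c).
have prod_neq0 : \prod_(c <- s) (D - mpolyC n c) != 0.
  by rewrite prodf_seq_neq0; apply/allP => c _; apply: Dc_neq0.
split; first by rewrite mulf_neq0 ?expf_neq0.
rewrite mleadM ?expf_neq0 // mleadX // mlead_prod // D_lead.
apply/mnmP => l; rewrite mnmDE !mulmnE mnm_sumE.
under eq_bigr do rewrite Dc_lead.
by rewrite big_const_seq count_predT iter_addn_0 -mulnDr subnK.
Qed.

Local Open Scope fset_scope.

Theorem corollary1p2 (F : fieldType) (n : nat) (hn : (0 < n)%N) (A : {fset F})
    (a : 'I_n -> F) (ha : forall i, a i != 0) :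
  (forall (f : {poly F}) (m : nat), size f = m.+1 -> (1 <= m)%N ->
     (Order.min (p_of F - ((m * 'C(n, 2))%N%:Z)%:E)
        (n%:Z * (#|` A|%:Z - 1 - m%:Z * (n%:Z - 1)) + 1)%R%:E
      <= ((#|` restricted_sums a A
                (fun x => [forall i, forall j,
                   (i != j) ==> (f.[x i] != f.[x j])%R])|)%:Z)%:E)%E)
  /\
  (forall (m : nat) (S : 'I_n -> 'I_n -> {fset F}), (0 < m)%N ->
     (forall i j : 'I_n, (i < j)%N -> (#|` S i j| <= 2 * m - 1)%N) ->
     (Order.min (p_of F - ((2 * m%:Z - 1) * 'C(n, 2)%:Z)%R%:E)
        (n%:Z * (#|` A|%:Z - 1 - (2 * m%:Z - 1) * (n%:Z - 1)) + 1)%R%:E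
      <= ((#|` restricted_sums a A
                (fun x => [forall i : 'I_n, forall j : 'I_n,
                   (i < j)%N ==> ((x i - x j)%R \notin S i j)])|)%:Z)%:E)%E).
Proof.
split=> [f m szf m_gt0|m S m_gt0 S_card].
  apply: (p_of_sums_card_ge (g := poly_gap f)) => // [i j ij|x xA gx].
    have lead := mlead_poly_gap ij m_gt0 szf.
    by split=> //; apply: mlead_neq0 lead.
  apply/in_restricted_sums; exists x; split=> //.
  apply/forallP => i; apply/forallP => j; apply/implyP.
  rewrite neq_ltn -subr_eq0 => /orP[/gx|/gx]; rewrite meval_poly_gap //.
  by rewrite -oppr_eq0 opprB.
have ME : 2 * m%:Z - 1 = (2 * m - 1)%N%:Z by rewrite -subzn ?PoszM //; lia.
rewrite ME -PoszM; set M := (2 * m - 1)%N in S_card *.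
apply: (p_of_sums_card_ge (g := fun i j => shifted_gap M (S i j) i j)) => //.
  by move=> i j ij; apply: mlead_shifted_gap => //; apply: S_card.
move=> x xA gx; apply/in_restricted_sums; exists x; split=> //.
apply/forallP => i; apply/forallP => j; apply/implyP => /gx.
by apply: contraNN => xS; rewrite meval_shifted_gap_eq0.
Qed.
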